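(* Let $\mathcal{A}$ be an assessment on $\mathcal{L}$. Then its closure in the set of models equals the intersection of the maximal models dominating it: $\operatorname{cl}_{\mathbb{M}}\mathcal{A}=\bigcap\hat{\mathbb{M}}_{\mathcal{A}}$.
   Context: Let $\Omega$ be a non-empty set and let $\mathcal{L}$ be a real linear subspace of the vector space of all real-valued functions (''gambles'') on $\Omega$ with pointwise operations. For $\mathcal{K},\mathcal{K}'\subseteq\mathcal{L}$: $\mathcal{K}-\mathcal{K}'=\{f-g:f\in\mathcal{K},g\in\mathcal{K}'\}$ (empty if either set is empty); $\overline{\mathcal{K}}=\{\lambda f:\lambda>0,f\in\mathcal{K}\}$; $\operatorname{posi}\mathcal{K}$ is the set of all linear combinations with strictly positive coefficients of non-empty finite families of elements of $\mathcal{K}$ (so $\operatorname{posi}\emptyset=\emptyset$). A cone is a set $\mathcal{K}\subseteq\mathcal{L}$ with $\operatorname{posi}\mathcal{K}=\mathcal{K}$. An assessment is a pair $\mathcal{A}=\langle\mathcal{A}_{\mathrm{acc}};\mathcal{A}_{\mathrm{rej}}\rangle$ of subsets of $\mathcal{L}$. Inclusion and intersection of assessments are component-wise; the intersection of the empty family of assessments is $\top=\langle\mathcal{L};\mathcal{L}\rangle$. A model without confusion is an assessment $\mathcal{M}$ such that $\mathcal{M}_{\mathrm{acc}}\cap\mathcal{M}_{\mathrm{rej}}=\emptyset$, $\mathcal{M}_{\mathrm{acc}}$ is a cone, and $\overline{\mathcal{M}_{\mathrm{rej}}}\cup(\overline{\mathcal{M}_{\mathrm{rej}}}-\mathcal{M}_{\mathrm{acc}})\subseteq\mathcal{M}_{\mathrm{rej}}$.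 The set of these is $\mathbb{M}$; $\hat{\mathbb{M}}$ is the set of maximal elements of $(\mathbb{M},\subseteq)$; $\mathbb{M}_{\mathcal{A}}=\{\mathcal{M}\in\mathbb{M}:\mathcal{A}\subseteq\mathcal{M}\}$ and $\hat{\mathbb{M}}_{\mathcal{A}}=\hat{\mathbb{M}}\cap\mathbb{M}_{\mathcal{A}}$. The closure operator is $\operatorname{cl}_{\mathbb{M}}\mathcal{A}=\bigcap\mathbb{M}_{\mathcal{A}}$. *)

(* Defs.v *)
From HB Require Import structures.
From mathcomp Require Import all_boot all_order all_algebra.
From mathcomp Require Import all_classical all_reals.

Set Implicit Arguments.
Unset Strict Implicit.
Unset Printing Implicit Defensive.

Import Order.TTheory GRing.Theory Num.Theory.

Local Open Scope classical_set_scope.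
Local Open Scope ring_scope.

(* R^o, rather than R, makes the pointwise operations a left-module structure
   over R. *)
Notation gamble Omega R := (Omega -> R^o) (only parsing).

Section Assessments.
Context {R : realType} {Omega : Type}.

Implicit Types K : set (gamble Omega R).

Definition diff_set K K' : set (gamble Omega R) :=
  [set f - g | f in K & g in K'].

(* Closure under positive scaling, written with an overline on paper. *)
Definition pos_scale K : set (gamble Omega R) :=
  [set h | exists2 a : R, 0 < a & exists2 f, K f & h = a *: f].

(* Families are indexed by 'I_n.+1: they are non-empty, so posi set0 = set0. *)
Definition posi K : set (gamble Omega R) :=
  [set h | exists n (a : 'I_n.+1 -> R) (f : 'I_n.+1 -> gamble Omega R),
    [/\ forall i, 0 < a i, forall i, K (f i) & h = \sum_i a i *: f i]].

(* A pair of sets of gambles; that both consist of gambles in L is the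
   separate condition [is_assessment L]. *)
Record assessment := Assessment {
  acc : set (gamble Omega R);
  rej : set (gamble Omega R) }.

Definition assessment_le (A B : assessment) : Prop :=
  acc A `<=` acc B /\ rej A `<=` rej B.

Variable L : set (gamble Omega R).

Definition is_assessment (A : assessment) : Prop :=
  acc A `<=` L /\ rej A `<=` L.

(* Intersecting with L makes the empty meet Assessment L L; it changes nothing
   for a non-empty family of assessments on L. *)
Definition assessment_bigcap (F : set assessment) : assessment :=
  Assessment (L `&` \bigcap_(M in F) acc M) (L `&` \bigcap_(M in F) rej M).

Definition is_cone K : Prop := K `<=` L /\ posi K = K.

Definition models : set assessment :=
  [set M | [/\ is_assessment M,
    acc M `&` rej M = set0,
    is_cone (acc M) &
    pos_scale (rej M) `|` diff_set (pos_scale (rej M)) (acc M) `<=` rej M]].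

Definition maximal_models : set assessment :=
  [set M | models M /\
    forall M', models M' -> assessment_le M M' -> M' = M].

Definition models_above (A : assessment) : set assessment :=
  [set M | models M /\ assessment_le A M].

Definition maximal_models_above (A : assessment) : set assessment :=
  maximal_models `&` models_above A.

Definition cl_models (A : assessment) : assessment :=
  assessment_bigcap (models_above A).

End Assessments.

(* Main.v *)
Require Import Defs.
From HB Require Import structures.
From mathcomp Require Import all_boot all_order all_algebra.
From mathcomp Require Import all_classical all_reals.

Set Implicit Arguments.
Unset Strict Implicit.
Unset Printing Implicit Defensive.

Import Order.TTheory GRing.Theory Num.Theory.

Local Open Scope classical_set_scope.
Local Open Scope ring_scope.

(** The maximal models dominating the assessment [A] are among all the models
    dominating it, so the closure of [A] is contained in their intersection.
    For the converse, a gamble outside one component of some model [M] above [A]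
    must be kept out of that component of some maximal model above [M].  This
    is done by putting it in the other component: if [f] is not accepted by
    [M], then [f] can be rejected consistently ([reject_extension]); if [f] is
    not rejected by [M], then [f] can be accepted consistently
    ([accept_extension]).  Either extension lies below a maximal model by
    Zorn's lemma ([maximal_model_exists]), because unions of non-empty chains
    of models are models, and a maximal model, being without confusion, keeps
    [f] out of the component in question. *)

(** * Elementary form of the axioms of a model *)

Section ModelExtensions.
Context {R : realType} {Omega : Type}.
Implicit Types (K : set (gamble Omega R)) (f g h : gamble Omega R).
Implicit Types M : @assessment R Omega.

(** Closure under positive scaling and addition, which is what [posi K = K]
    amounts to ([posi_idP]). *)
Definition pos_closed K : Prop :=
  (forall (a : R) f, 0 < a -> K f -> K (a *: f)) /\
  (forall f g, K f -> K g -> K (f + g)).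

Lemma posi_idP K : posi K = K <-> pos_closed K.
Proof.
split=> [KE|[KZ KD]].
  split=> [a f a0 Kf|f g Kf Kg]; rewrite -KE.
    by exists 0%N, (fun=> a), (fun=> f); rewrite big_ord1.
  exists 1%N, (fun=> 1), (fun i => if i == ord0 then f else g).
  split=> [i|i|]; first exact: ltr01.
    by case: ifP.
  by rewrite big_ord_recl big_ord1 /= !scale1r.
apply/seteqP; split=> [h [n [a [f [a0 Kf ->]]]]|f Kf].
  elim: n a f a0 Kf => [|n IHn] a f a0 Kf.
    by rewrite big_ord1; exact: KZ.
  rewrite big_ord_recl; apply: KD; first exact: KZ.
  by apply: (IHn (a \o lift ord0) (f \o lift ord0)) => i /=.
exists 0%N, (fun=> 1), (fun=> f).
by split=> //; rewrite big_ord1 scale1r.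
Qed.

(** The axioms of a model, with the cone condition and the rejection condition
    unfolded into elementary closure properties. *)
Lemma modelsP (L : set (gamble Omega R)) M :
  models L M <->
  [/\ is_assessment L M,
      (forall f, acc M f -> rej M f -> False),
      pos_closed (acc M),
      (forall (a : R) f, 0 < a -> rej M f -> rej M (a *: f)) &
      (forall f g, rej M f -> acc M g -> rej M (f - g))].
Proof.
split=> [[ML dis [_ /posi_idP accM] rejM]|[ML dis accM rejZ rejB]].
  have rejZ (a : R) f : 0 < a -> rej M f -> rej M (a *: f).
    by move=> a0 Mf; apply: rejM; left; exists a => //; exists f.
  split=> // [f Af Rf|f g Rf Ag].
    by have : (acc M `&` rej M) f by []; rewrite dis.
  apply: rejM; right; exists f; last by exists g.
  by exists 1; [exact: ltr01|exists f; rewrite ?scale1r].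
split=> //.
- by rewrite -subset0 => f [Af Rf]; exact: (dis f).
- by split; [exact: ML.1|exact/posi_idP].
- move=> h [[a a0 [f Rf ->]]|]; first exact: rejZ.
  by move=> [_ [a a0 [f Rf ->]] [g Ag <-]]; apply: rejB => //; exact: rejZ.
Qed.

(** * Existence of maximal models *)

Lemma assessment_le_refl M : assessment_le M M.
Proof. by split. Qed.

Lemma assessment_le_trans M1 M2 M3 :
  assessment_le M1 M2 -> assessment_le M2 M3 -> assessment_le M1 M3.
Proof. by move=> [a1 r1] [a2 r2]; split; apply: subset_trans; eauto. Qed.

Lemma assessment_le_anti M1 M2 :
  assessment_le M1 M2 -> assessment_le M2 M1 -> M1 = M2.
Proof.
case: M1 M2 => [a1 r1] [a2 r2] [/= aS rS] [/= aS' rS'].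
by congr Assessment; apply/seteqP.
Qed.

(** The component-wise union. *)
Definition assessment_bigcup (C : set (@assessment R Omega)) :
    @assessment R Omega :=
  Assessment (\bigcup_(M in C) acc M) (\bigcup_(M in C) rej M).

Lemma chain_bigcup_models (L : set (gamble Omega R)) (C : set assessment) :
  total_on C assessment_le -> C `<=` models L ->
  models L (assessment_bigcup C).
Proof.
move=> totC CL.
(* two members of a chain are both dominated by one of them *)
have ub M M' : C M -> C M' ->
    exists N, [/\ C N, models L N, assessment_le M N & assessment_le M' N].
  move=> CM CM'; case: (totC M M' CM CM') => le.
    by exists M'; split=> //; [exact: CL|exact: assessment_le_refl].
  by exists M; split=> //; [exact: CL|exact: assessment_le_refl].
apply/modelsP; split.
- by split=> f [M /CL/modelsP[[aL rL] _ _ _ _]] Mf; [exact: aL|exact: rL].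
- move=> f [M CM Af] [M' CM' Rf].
  have [N [_ /modelsP[_ dis _ _ _] [aS _] [_ rS]]] := ub _ _ CM CM'.
  by apply: (dis f); [exact: aS|exact: rS].
- split=> [a f a0 [M CM Mf]|f g [M CM Mf] [M' CM' Mg]].
    by have /modelsP[_ _ [MZ _] _ _] := CL _ CM; exists M => //; exact: MZ.
  have [N [CN /modelsP[_ _ [_ ND] _ _] [aS _] [aS' _]]] := ub _ _ CM CM'.
  by exists N => //; apply: ND; [exact: aS|exact: aS'].
- move=> a f a0 [M CM Mf].
  by have /modelsP[_ _ _ MZ _] := CL _ CM; exists M => //; exact: MZ.
- move=> f g [M CM Mf] [M' CM' Mg].
  have [N [CN /modelsP[_ _ _ _ NB] [_ rS] [aS _]]] := ub _ _ CM CM'.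
  by exists N => //; apply: NB; [exact: rS|exact: aS].
Qed.

Lemma maximal_model_exists (L : set (gamble Omega R)) M :
  models L M -> exists2 M', maximal_models L M' & assessment_le M M'.
Proof.
move=> mM.
pose T := {N : assessment | models_above L M N}.
pose le (N N' : T) := `[< assessment_le (sval N) (sval N') >].
have [|||C totC|[N [mN leN]] maxN] := @Zorn T le.
- by move=> ?; apply/asboolP; exact: assessment_le_refl.
- move=> ? ? ? /asboolP l /asboolP l'; apply/asboolP.
  exact: assessment_le_trans l l'.
- move=> [N pN] [N' pN'] /asboolP l /asboolP l'; apply: eq_exist.
  exact: assessment_le_anti.
- have [->|/set0P[N0 CN0]] := eqVneq C set0.
    by exists (exist (models_above L M) M (conj mM (assessment_le_refl M))).
  have mU : models L (assessment_bigcup (sval @` C)).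
    apply: chain_bigcup_models => [_ _ [N CN <-] [N' CN' <-]|_ [N _ <-]].
      by case: (totC _ _ CN CN') => /asboolP; [left|right].
    exact: (svalP N).1.
  have leU N : C N -> assessment_le (sval N) (assessment_bigcup (sval @` C)).
    by move=> CN; split=> f Nf; exists (sval N) => //; exists N.
  (* [N0] makes the union dominate [M], so the chain must be non-empty *)
  have MU := assessment_le_trans (svalP N0).2 (leU _ CN0).
  by exists (exist (models_above L M) _ (conj mU MU)) => N CN; apply/asboolP; exact: leU.
exists N => //; split=> // N' mN' leN'.
have MN' := assessment_le_trans leN leN'.
by have [] := maxN (exist (models_above L M) N' (conj mN' MN')) (asboolT leN').
Qed.

(** * Rejecting or accepting one more gamble *)

(** Adjoining the zero gamble allows [a *: f] and [a *: f + g] to be treated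
    as a single case. *)
Definition with0 K : set (gamble Omega R) := [set g | g = 0 \/ K g].

Lemma pos_closed_with0 K : pos_closed K -> pos_closed (with0 K).
Proof.
move=> [KZ KD]; split=> [a f a0 [->|Kf]|f g [->|Kf] [->|Kg]].
- by left; rewrite scaler0.
- by right; exact: KZ.
- by left; rewrite addr0.
- by right; rewrite add0r.
- by right; rewrite addr0.
- by right; exact: KD.
Qed.

(** For a cone [K], the cone generated by [K] and [f]. *)
Definition cone_adjoin K f : set (gamble Omega R) :=
  [set h | K h \/
    exists2 a : R, 0 < a & exists2 g, with0 K g & h = a *: f + g].

Lemma cone_adjoin_closed K f : pos_closed K -> pos_closed (cone_adjoin K f).
Proof.
move=> cK; have [KZ KD] := cK; have [ZK0 DK0] := pos_closed_with0 cK.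
split=> [a h a0 [Kh|[b b0 [g Kg ->]]]|h h'].
- by left; exact: KZ.
- right; exists (a * b); first exact: mulr_gt0.
  by exists (a *: g); [exact: ZK0|rewrite scalerDr scalerA].
- move=> [Kh|[a a0 [g Kg ->]]] [Kh'|[b b0 [g' Kg' ->]]].
  + by left; exact: KD.
  + right; exists b => //; exists (h + g'); last by rewrite addrCA.
    by apply: DK0 => //; right.
  + right; exists a => //; exists (g + h'); last by rewrite addrA.
    by apply: DK0 => //; right.
  + right; exists (a + b); first exact: addr_gt0.
    by exists (g + g'); [exact: DK0|rewrite scalerDl addrACA].
Qed.

Variable L : set (gamble Omega R).
Hypothesis L_subspace : submod_closed [in L].

Lemma subspaceZD (a : R) f g : L f -> L g -> L (a *: f + g).
Proof.
by move=> /mem_set Lf /mem_set Lg; apply/set_mem; exact: L_subspace.2.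
Qed.

Lemma subspaceZ (a : R) f : L f -> L (a *: f).
Proof.
move=> Lf; rewrite -[_ *: _]addr0; apply: subspaceZD => //.
by apply/set_mem; exact: L_subspace.1.
Qed.

Lemma subspaceB f g : L f -> L g -> L (f - g).
Proof. by move=> Lf Lg; rewrite addrC -scaleN1r; exact: subspaceZD. Qed.

Lemma subspace_with0 K : K `<=` L -> with0 K `<=` L.
Proof. by move=> KL g [->|/KL//]; apply/set_mem; exact: L_subspace.1. Qed.

Lemma rej_with0 M f g :
  models L M -> rej M f -> with0 (acc M) g -> rej M (f - g).
Proof.
by move=> /modelsP[_ _ _ _ rejB] Rf [->|]; [rewrite subr0|exact: rejB].
Qed.

Lemma acc_with0 M f g :
  models L M -> acc M f -> with0 (acc M) g -> acc M (f + g).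
Proof.
by move=> /modelsP[_ _ [_ accD] _ _] Af [->|]; [rewrite addr0|exact: accD].
Qed.

(** The rejected gambles of the extension are those of [M] together with
    [a *: f - g], for [a > 0] and [g] zero or accepted.  Accepting such a
    gamble would make [a *: f], hence [f], accepted by [M]. *)
Lemma reject_extension M f : models L M -> L f -> ~ acc M f ->
  exists M', [/\ models L M', assessment_le M M' & rej M' f].
Proof.
move=> mM Lf nf; have /modelsP[[aL rL] dis cM rejZ rejB] := mM.
have [ZA0 DA0] := pos_closed_with0 cM.
pose Q := rej M `|` [set h | exists2 a : R, 0 < a &
  exists2 g, with0 (acc M) g & h = a *: f - g].
exists (Assessment (acc M) Q); split; last first.
- right; exists 1; first exact: ltr01.
  by exists 0; [left|rewrite scale1r subr0].
- by split=> //= h; left.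
apply/modelsP; split=> //=.
- split=> //= h [/rL//|[a _ [g Ag ->]]].
  by apply: subspaceB; [exact: subspaceZ|exact: subspace_with0 Ag].
- move=> h Ah [|[a a0 [g Ag hE]]]; first exact: dis.
  apply: nf; have : acc M (h + g) by exact: acc_with0.
  have a'0 : 0 < a^-1 by rewrite invr_gt0.
  by rewrite hE subrK => /(cM.1 _ _ a'0); rewrite scalerK// lt0r_neq0.
- move=> a h a0 [Rh|[b b0 [g Ag ->]]]; first by left; exact: rejZ.
  right; exists (a * b); first exact: mulr_gt0.
  by exists (a *: g); [exact: ZA0|rewrite scalerBr scalerA].
- move=> h k [Rh|[b b0 [g Ag ->]]] Ak; first by left; exact: rejB.
  right; exists b => //; exists (g + k); last by rewrite opprD addrA.
  by apply: DA0 => //; right.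
Qed.

(** The accepted gambles of the extension are the cone [P] generated by [acc M]
    and [f]; the rejected ones are [r - p], for [r] rejected by [M] and [p] zero
    or in [P].  If [r - p] were in [P], then so would be [r], so it suffices
    that [P] contains no gamble rejected by [M]. *)
Lemma accept_extension M f : models L M -> L f -> ~ rej M f ->
  exists M', [/\ models L M', assessment_le M M' & acc M' f].
Proof.
move=> mM Lf nf; have /modelsP[[aL rL] dis cM rejZ rejB] := mM.
pose P := cone_adjoin (acc M) f.
have cP : pos_closed P by exact: cone_adjoin_closed.
have [ZP0 DP0] := pos_closed_with0 cP.
have PL : P `<=` L.
  move=> h [/aL//|[a _ [g Ag ->]]].
  by apply: subspaceZD => //; exact: subspace_with0 Ag.
pose Q := [set h | exists2 r, rej M r & exists2 p, with0 P p & h = r - p].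
(* a rejected a *: f + g would make a *: f, hence f, rejected *)
have disP h : P h -> rej M h -> False.
  move=> [Ah|[a a0 [g Ag ->]]]; first exact: dis.
  move=> /rej_with0 => /(_ _ mM Ag); rewrite addrK.
  have a'0 : 0 < a^-1 by rewrite invr_gt0.
  by move=> /(rejZ _ _ a'0); rewrite scalerK// lt0r_neq0.
exists (Assessment P Q); split; last first.
- right; exists 1; first exact: ltr01.
  by exists 0; [left|rewrite scale1r addr0].
- split=> [h Ah|h Rh]; first by left.
  by exists h => //; exists 0; [left|rewrite subr0].
apply/modelsP; split=> //=.
- split=> //= _ [r /rL Lr [p Pp ->]].
  by apply: subspaceB => //; exact: subspace_with0 Pp.
- move=> h Ph [r Rr [p Pp hE]]; apply: (disP r) => //.
  rewrite -(subrK p r) -hE.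
  by case: Pp => [->|Pp]; [rewrite addr0|exact: cP.2].
- move=> a _ a0 [r Rr [p Pp ->]]; exists (a *: r); first exact: rejZ.
  by exists (a *: p); [exact: ZP0|rewrite scalerBr].
- move=> _ k [r Rr [p Pp ->]] Pk; exists r => //.
  by exists (p + k); [apply: DP0 => //; right|rewrite opprD addrA].
Qed.

End ModelExtensions.

(** * The closure as an intersection of maximal models *)

Theorem proposition2p18 (R : realType) (Omega : Type)
    (Omega_neq0 : [set: Omega] !=set0)
    (L : set (gamble Omega R)) (L_subspace : submod_closed [in L])
    (A : assessment) (A_on_L : is_assessment L A) :
  cl_models L A = assessment_bigcap L (maximal_models_above L A).
Proof.
apply: assessment_le_anti; split=> f /= [Lf fM]; split=> //.
- by move=> M [_ AM]; exact: fM.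
- by move=> M [_ AM]; exact: fM.
- move=> M [mM AM]; apply: contrapT => nf.
  have [M1 [mM1 MM1 M1f]] := reject_extension L_subspace mM Lf nf.
  have [M2 maxM2 M12] := maximal_model_exists mM1.
  have /modelsP[_ dis _ _ _] := maxM2.1.
  apply: (dis f); last exact: M12.2.
  apply: fM; split=> //; split; first exact: maxM2.1.
  exact: assessment_le_trans AM (assessment_le_trans MM1 M12).
- move=> M [mM AM]; apply: contrapT => nf.
  have [M1 [mM1 MM1 M1f]] := accept_extension L_subspace mM Lf nf.
  have [M2 maxM2 M12] := maximal_model_exists mM1.
  have /modelsP[_ dis _ _ _] := maxM2.1.
  apply: (dis f); first exact: M12.1.
  apply: fM; split=> //; split; first exact: maxM2.1.
  exact: assessment_le_trans AM (assessment_le_trans MM1 M12).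
Qed.
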